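(* Let $S\subset\mathbb{N}^\times\setminus\{1\}$ be a family of pairwise relatively prime natural numbers and $P=\langle S\rangle\subset\mathbb{N}^\times$ the monoid generated by $S$, acting on $\mathbb{Z}$ by multiplication $\theta_p(m)=pm$. Then the gauge action $\gamma\colon\mathbb{T}^{|S|}\curvearrowright\mathcal{Q}(\mathbb{Z}\rtimes P)$ is outer.
   Context: $\mathcal{Q}(\mathbb{Z}\rtimes P)$ is the universal $C^*$-algebra generated by a unitary $u$ and isometries $s_p$, $p\in P$, with $s_ps_q=s_{pq}$ and $s_1=1$, subject to (I) $s_pu^m=u^{pm}s_p$ for $m\in\mathbb{Z}$; (II) $s_p^*u^ms_q=u^{m_1}s_{p'}s_{q'}^*u^{m_2}$ if $m=pm_1+qm_2$ and $pP\cap qP=pp'P$, $pp'=qq'$, and $s_p^*u^ms_q=0$ if $m\notin p\mathbb{Z}+q\mathbb{Z}$; (III) $\sum_{m=0}^{p-1}u^ms_ps_p^*u^{-m}=1$ for all $p\in P$. The gauge action of $\mathbb{T}^{|S|}$ (the dual of the free abelian group $P^{-1}P$ on $S$) is given by $\gamma_\chi(u)=u$ and $\gamma_\chi(s_p)=\chi(p)s_p$ for $p\in S$. An action is outer if every non-trivial group element acts by an automorphism that is not of the form ${\rm Ad}(w)$ for a unitary $w$ in the algebra. *)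

(* Defs.v *)
From HB Require Import structures.
From mathcomp Require Import all_boot all_order all_algebra.
From mathcomp Require Import complex.
From mathcomp Require Import all_classical all_reals all_analysis.

Set Implicit Arguments.
Unset Strict Implicit.
Unset Printing Implicit Defensive.

Import Order.TTheory GRing.Theory Num.Theory.
Import numFieldNormedType.Exports.

Local Open Scope classical_set_scope.
Local Open Scope ring_scope.

(* The ring operations are fields of the mixin, rather than inherited from
   algType, since mathcomp has no join of normedModType with ringType; they are
   turned into an algType structure below.  The algebras are unital and nonzero,
   as for every algType.  The norm takes its values in R[i], where nonnegative
   elements are real; `_^*` on scalars is complex conjugation. *)
HB.mixin Record isCStarAlgebra (R : realType) A
    of CompleteNormedModule R[i] A := {
  cstar_one : A ;
  cstar_mul : A -> A -> A ;
  star : A -> A ;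
  cstar_mulA : associative cstar_mul ;
  cstar_mul1 : left_id cstar_one cstar_mul ;
  cstar_mulr1 : right_id cstar_one cstar_mul ;
  cstar_mulDl : left_distributive cstar_mul +%R ;
  cstar_mulDr : right_distributive cstar_mul +%R ;
  cstar_one_neq0 : cstar_one != 0 ;
  cstar_scaleAl : forall (c : R[i]) (x y : A),
    c *: cstar_mul x y = cstar_mul (c *: x) y ;
  cstar_scaleAr : forall (c : R[i]) (x y : A),
    c *: cstar_mul x y = cstar_mul x (c *: y) ;
  starK : involutive star ;
  starD : {morph star : x y / x + y} ;
  starZ : forall (c : R[i]) (x : A), star (c *: x) = c^* *: star x ;
  starM : forall x y : A, star (cstar_mul x y) = cstar_mul (star y) (star x) ;
  cstar_normM : forall x y : A, `|cstar_mul x y| <= `|x| * `|y| ;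
  cstar_norm_star : forall x : A, `|cstar_mul (star x) x| = `|x| ^+ 2
}.

#[short(type="cstarAlgType")]
HB.structure Definition CStarAlgebra (R : realType) :=
  {A of isCStarAlgebra R A & CompleteNormedModule R[i] A}.

HB.instance Definition _ (R : realType) (A : cstarAlgType R) :=
  GRing.Zmodule_isNzRing.Build (CStarAlgebra.sort A)
    (@cstar_mulA R A) (@cstar_mul1 R A) (@cstar_mulr1 R A) (@cstar_mulDl R A)
    (@cstar_mulDr R A) (@cstar_one_neq0 R A).

HB.instance Definition _ (R : realType) (A : cstarAlgType R) :=
  GRing.Lmodule_isLalgebra.Build R[i] (CStarAlgebra.sort A) (@cstar_scaleAl R A).

HB.instance Definition _ (R : realType) (A : cstarAlgType R) :=
  GRing.Lalgebra_isAlgebra.Build R[i] (CStarAlgebra.sort A) (@cstar_scaleAr R A).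

Section CStar.
Variables (R : realType) (A : cstarAlgType R).

Lemma cstar_oneE : cstar_one = 1 :> A.
Proof. by []. Qed.

Lemma cstar_mulE (x y : A) : cstar_mul x y = x * y.
Proof. by []. Qed.

Definition is_unitary (u : A) : Prop := star u * u = 1 /\ u * star u = 1.

Definition is_isometry (v : A) : Prop := star v * v = 1.

(* u ^ m for m : int, with u^-1 = star u; only used for unitary u *)
Definition unitary_pow (u : A) (m : int) : A :=
  match m with Posz n => u ^+ n | Negz n => star u ^+ n.+1 end.

Definition closed_star_subalgebra (M : set A) : Prop :=
  [/\ closed M, M 1, (forall (c : R[i]) x y, M x -> M y -> M (c *: x + y)),
      (forall x y, M x -> M y -> M (x * y)) & (forall x, M x -> M (star x))].

Definition cstar_generated (G : set A) : set A :=
  smallest closed_star_subalgebra G.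

End CStar.

(* No continuity is required: *-homomorphisms of C*-algebras are contractive. *)
Definition star_preserving (R : realType) (A B : cstarAlgType R)
  (phi : A -> B) : Prop := forall x, phi (star x) = star (phi x).

Definition submonoid (M : set nat) : Prop :=
  M 1%N /\ forall p q, M p -> M q -> M (p * q)%N.

Definition monoid_gen (S : set nat) : set nat := smallest submonoid S.

Definition right_ideal (P : set nat) (p : nat) : set nat :=
  [set (p * x)%N | x in P].

(* The family s is indexed by nat, but only its values on P are relevant. *)
Record Q_relations (R : realType) (P : set nat) (A : cstarAlgType R)
    (u : A) (s : nat -> A) : Prop := {
  Q_unitary : is_unitary u ;
  Q_isometry : forall p, P p -> is_isometry (s p) ;
  Q_one : s 1%N = 1 ;
  Q_mul : forall p q, P p -> P q -> s p * s q = s (p * q)%N ;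
  Q_I : forall p (m : int), P p ->
    s p * unitary_pow u m = unitary_pow u (p%:Z * m) * s p ;
  Q_II : forall p q p' q' (m m1 m2 : int), P p -> P q -> P p' -> P q' ->
    m = p%:Z * m1 + q%:Z * m2 ->
    right_ideal P p `&` right_ideal P q = right_ideal P (p * p')%N ->
    (p * p' = q * q')%N ->
    star (s p) * unitary_pow u m * s q =
      unitary_pow u m1 * s p' * star (s q') * unitary_pow u m2 ;
  Q_II0 : forall p q (m : int), P p -> P q ->
    ~ (exists m1 m2 : int, m = p%:Z * m1 + q%:Z * m2) ->
    star (s p) * unitary_pow u m * s q = 0 ;
  Q_III : forall p, P p ->
    \sum_(0 <= m < p)
      unitary_pow u m%:Z * s p * star (s p) * unitary_pow u (- m%:Z) = 1
}.

(* (A, u, s) is the universal C*-algebra Q(Z x| P) *)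
Record is_Q (R : realType) (P : set nat) (A : cstarAlgType R)
    (u : A) (s : nat -> A) : Prop := {
  is_Q_relations : Q_relations P u s ;
  is_Q_generated : cstar_generated (u |` [set s p | p in P]) = setT ;
  is_Q_universal : forall (B : cstarAlgType R) (v : B) (t : nat -> B),
    Q_relations P v t ->
    exists phi : {lrmorphism A -> B},
      [/\ star_preserving phi, phi u = v & forall p, P p -> phi (s p) = t p]
}.

Definition circle (R : realType) := {z : R[i] | `|z| == 1}.

HB.instance Definition _ (R : realType) := [isSub of circle R for sval].
HB.instance Definition _ (R : realType) := [Choice of circle R by <:].

Section CircleGroup.
Variable R : realType.

Let one_subproof : `|1 : R[i]| == 1.
Proof. by rewrite normr1. Qed.

Let mul_subproof (x y : circle R) : `|val x * val y| == 1.
Proof. by rewrite normrM (eqP (valP x)) (eqP (valP y)) mulr1. Qed.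

Let inv_subproof (x : circle R) : `|(val x)^-1| == 1.
Proof. by rewrite normfV (eqP (valP x)) invr1. Qed.

Definition circle_one : circle R := exist _ 1 one_subproof.
Definition circle_mul (x y : circle R) : circle R :=
  exist _ (val x * val y) (mul_subproof x y).
Definition circle_inv (x : circle R) : circle R :=
  exist _ (val x)^-1 (inv_subproof x).

Lemma circle_mulA : associative circle_mul.
Proof. by move=> x y z; apply: val_inj; rewrite /= mulrA. Qed.

Lemma circle_mul1 : left_id circle_one circle_mul.
Proof. by move=> x; apply: val_inj; rewrite /= mul1r. Qed.

Lemma circle_mulr1 : right_id circle_one circle_mul.
Proof. by move=> x; apply: val_inj; rewrite /= mulr1. Qed.

Lemma circle_neq0 (x : circle R) : val x != 0.
Proof. by rewrite -normr_eq0 (eqP (valP x)) oner_eq0. Qed.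

Lemma circle_mulV : left_inverse circle_one circle_inv circle_mul.
Proof. by move=> x; apply: val_inj; rewrite /= mulVf ?circle_neq0. Qed.

Lemma circle_mulrV : right_inverse circle_one circle_inv circle_mul.
Proof. by move=> x; apply: val_inj; rewrite /= mulfV ?circle_neq0. Qed.

HB.instance Definition _ := isGroup.Build (circle R)
  circle_mulA circle_mul1 circle_mulr1 circle_mulV circle_mulrV.

End CircleGroup.

(* T^|S|: families of elements of T indexed by S, under pointwise
   multiplication; S may be infinite *)
Definition torus (R : realType) (S : set nat) := set_type S -> circle R.

HB.instance Definition _ (R : realType) (S : set nat) :=
  Choice.on (torus R S).

Section TorusGroup.
Variables (R : realType) (S : set nat).
Implicit Types chi : torus R S.

Definition torus_one : torus R S := fun=> 1%g.
Definition torus_mul chi chi' : torus R S := fun p => (chi p * chi' p)%g.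
Definition torus_inv chi : torus R S := fun p => (chi p)^-1%g.

Lemma torus_mulA : associative torus_mul.
Proof. by move=> x y z; apply/funext => p; rewrite /torus_mul mulgA. Qed.

Lemma torus_mul1 : left_id torus_one torus_mul.
Proof. by move=> x; apply/funext => p; rewrite /torus_mul mul1g. Qed.

Lemma torus_mulr1 : right_id torus_one torus_mul.
Proof. by move=> x; apply/funext => p; rewrite /torus_mul mulg1. Qed.

Lemma torus_mulV : left_inverse torus_one torus_inv torus_mul.
Proof. by move=> x; apply/funext => p; rewrite /torus_mul mulVg. Qed.

Lemma torus_mulrV : right_inverse torus_one torus_inv torus_mul.
Proof. by move=> x; apply/funext => p; rewrite /torus_mul mulgV. Qed.

HB.instance Definition _ := isGroup.Build (torus R S)
  torus_mulA torus_mul1 torus_mulr1 torus_mulV torus_mulrV.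

End TorusGroup.

(* Each gam g is an automorphism, with inverse gam g^-1. *)
Definition cstar_action (R : realType) (G : groupType) (A : cstarAlgType R)
    (gam : G -> {lrmorphism A -> A}) : Prop :=
  [/\ forall g, star_preserving (gam g),
      forall a, gam 1%g a = a
    & forall g h a, gam (g * h)%g a = gam g (gam h a)].

Definition inner (R : realType) (A : cstarAlgType R) (phi : A -> A) : Prop :=
  exists w : A, is_unitary w /\ forall a, phi a = w * a * star w.

Definition outer_action (R : realType) (G : groupType) (A : cstarAlgType R)
    (gam : G -> {lrmorphism A -> A}) : Prop :=
  forall g, g <> 1%g -> ~ inner (gam g).

(* As u and the s p, p in S, generate the algebra, these formulas determine
   the action. *)
Definition gauge_action (R : realType) (S : set nat) (A : cstarAlgType R)
    (u : A) (s : nat -> A) (gam : torus R S -> {lrmorphism A -> A}) : Prop :=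
  [/\ cstar_action gam,
      forall chi, gam chi u = u
    & forall chi (p : set_type S),
        gam chi (s (val p)) = val (chi p) *: s (val p)].

(* Main.v *)
Require Import Defs.
From HB Require Import structures.
From mathcomp Require Import all_boot all_order all_algebra.
From mathcomp Require Import complex.
From mathcomp Require Import all_classical all_reals all_analysis.
From mathcomp Require Import ring zify.

Set Implicit Arguments.
Unset Strict Implicit.
Unset Printing Implicit Defensive.

Import Order.TTheory GRing.Theory Num.Theory.
Import numFieldNormedType.Exports.

Local Open Scope classical_set_scope.
Local Open Scope ring_scope.

(** Suppose that a gauge automorphism is [Ad w]. Then [w] commutes with [u],
    and [w s_r = c_r s_r w] with [|c_r| = 1] for every [r] in [P]. The point is
    that these commutation rules force [w] to be a scalar; then [w] commutes
    with the [s_p] too, so all the [c_p] equal 1 and the automorphism was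
    trivial.

    To see that [w] is a scalar, compress it by an isometry [v = u^k s_r]: the
    rules give [v^* w v = c_r w], so it suffices that the compressions of [w]
    come arbitrarily close to scalars, for suitable [k] and [r]. The words
    [u^m s_p s_q^* u^n] span a dense *-subalgebra ([word_span_dense]), so [w] is
    close to a finite combination of words. Such a word is a partial bijection
    of the integers, [i |-> m + p (i + n) / q], defined where [q] divides
    [i + n], and compressing by [v] examines this map on the residue class
    [k + r Z]. Unless the map is a partial identity it has at most one fixed
    point. If [k] is not a fixed point and [r] is sufficiently divisible, the
    map moves the class off itself, and the compression vanishes; if the map is
    a partial identity, the class lies in its domain or is disjoint from it, and
    the compression is 1 or 0. Hence one pair [k], [r] makes the compressions of
    any finite number of words scalar at once ([exists_compression]).
    Compressing does not increase the norm, so [w] is as close to the scalars as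
    to the combination of words. *)

(** * Norm estimates in C*-algebras *)

Section CStarAlgebras.
Variables (R : realType) (A : cstarAlgType R).
Implicit Types (x y v : A) (M : set A).

Lemma star_mul x y : star (x * y) = star y * star x.
Proof. exact: starM. Qed.

Lemma star0 : star (0 : A) = 0.
Proof. by apply: (addrI (star 0)); rewrite -starD !addr0. Qed.

Lemma starN x : star (- x) = - star x.
Proof. by apply: (addrI (star x)); rewrite -starD !subrr star0. Qed.

Lemma star1 : star (1 : A) = 1.
Proof. by rewrite -[LHS]mulr1 -{2}[1]starK -star_mul mulr1 starK. Qed.

Lemma starX x n : star (x ^+ n) = star x ^+ n.
Proof. by elim: n => [|n IHn]; rewrite ?star1 // exprS star_mul IHn exprSr. Qed.

Lemma norm_mul_le x y : `|x * y| <= `|x| * `|y|.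
Proof. exact: cstar_normM. Qed.

Lemma norm_star_mul x : `|star x * x| = `|x| ^+ 2.
Proof. exact: cstar_norm_star. Qed.

Lemma norm_star x : `|star x| = `|x|.
Proof.
have le y : `|y| <= `|star y|.
  have [->|y0] := eqVneq y 0; first by rewrite star0.
  have y_gt0 : 0 < `|y| by rewrite normr_gt0.
  by rewrite -(ler_pM2r y_gt0) -expr2 -norm_star_mul norm_mul_le.
by apply/le_anti; rewrite le andbT -{2}[x]starK le.
Qed.

Lemma cstar_norm1 : `|1 : A| = 1.
Proof.
apply: (@mulfI _ `|1 : A|); first by rewrite normr_eq0 oner_neq0.
by rewrite -expr2 -norm_star_mul star1 !mulr1.
Qed.

Lemma norm_isometry v : is_isometry v -> `|v| = 1.
Proof.
move=> v_iso; apply/eqP; rewrite -(@eqrXn2 _ 2) //.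
by rewrite -norm_star_mul v_iso cstar_norm1 expr1n.
Qed.

Lemma isometryM v y : is_isometry v -> is_isometry y -> is_isometry (v * y).
Proof.
rewrite /is_isometry => v_iso y_iso.
by rewrite star_mul mulrA -(mulrA (star y)) v_iso mulr1.
Qed.

Lemma norm_compression_le v x : is_isometry v -> `|star v * x * v| <= `|x|.
Proof.
move=> /norm_isometry v1; apply: le_trans (norm_mul_le _ _) _.
rewrite v1 mulr1; apply: le_trans (norm_mul_le _ _) _.
by rewrite norm_star v1 mul1r.
Qed.

Lemma near_scalar_commute x y :
  (forall e : R[i], 0 < e -> exists z : R[i], `|x - z%:A| < e) ->
  x * y = y * x.
Proof.
move=> near; apply/eqP; rewrite -subr_eq0 -normr_le0.
apply/ler_addgt0Pr => e e_gt0; rewrite add0r.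
have y_gt0 : 0 < `|y| + 1 by rewrite ltr_wpDl.
have [z xz] := near _ (divr_gt0 (divr_gt0 e_gt0 (ltr0Sn _ 1)) y_gt0).
have {}xz : `|x - z%:A| * `|y| <= e / 2.
  apply: (@le_trans _ _ (`|x - z%:A| * (`|y| + 1))).
    by rewrite ler_wpM2l // lerDl.
  by rewrite -ler_pdivlMr // ltW.
have -> : x * y - y * x = (x - z%:A) * y - y * (x - z%:A).
  by rewrite mulrBl mulrBr -scalerAl -scalerAr mul1r mulr1 opprB addrA subrK.
rewrite [e]splitr; apply: le_trans (ler_normB _ _) _.
apply: lerD; apply: le_trans (norm_mul_le _ _) _ => //.
by rewrite mulrC.
Qed.

(** The norm closure of [M]. *)
Definition approximable M : set A :=
  [set x | forall e : R[i], 0 < e -> exists2 y, M y & `|x - y| < e].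

Lemma sub_approximable M : M `<=` approximable M.
Proof. by move=> x Mx e e_gt0; exists x => //; rewrite subrr normr0. Qed.

Lemma closed_approximable M : closed (approximable M).
Proof.
move=> x xcl e e_gt0; have e2 : 0 < e / 2 by rewrite divr_gt0.
have [z [Mz]] := xcl _ (nbhsx_ballx x _ e2).
rewrite -ball_normE /= => xz; have [y My zy] := Mz _ e2.
exists y => //; rewrite -(subrK z x) -addrA [e]splitr.
by apply: le_lt_trans (ler_normD _ _) _; apply: ltrD.
Qed.

Lemma closed_star_subalgebra_approximable M :
  M 1 -> (forall (c : R[i]) x y, M x -> M y -> M (c *: x + y)) ->
  (forall x y, M x -> M y -> M (x * y)) -> (forall x, M x -> M (star x)) ->
  closed_star_subalgebra (approximable M).
Proof.
move=> M1 Mlin Mmul Mstar.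
have lt (a b d : R[i]) : 0 <= a -> 0 <= b -> a < d / (b + 1) -> a * b < d.
  move=> a0 b0; rewrite ltr_pdivlMr ?ltr_wpDl //; apply: le_lt_trans.
  by rewrite ler_wpM2l // lerDl.
split.
- exact: closed_approximable.
- exact: sub_approximable.
- move=> c x y Mx My e e_gt0.
  have e2 : 0 < e / 2 by rewrite divr_gt0.
  have c_gt0 : 0 < `|c| + 1 by rewrite ltr_wpDl.
  have [x' Mx' xx'] := Mx _ (divr_gt0 e2 c_gt0).
  have [y' My' yy'] := My _ e2.
  exists (c *: x' + y'); first exact: Mlin.
  have -> : c *: x + y - (c *: x' + y') = c *: (x - x') + (y - y').
    by rewrite scalerBr opprD addrACA.
  rewrite [e]splitr; apply: le_lt_trans (ler_normD _ _) _; apply: ltrD => //.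
  by rewrite normrZ mulrC; exact: lt.
- move=> x y Mx My e e_gt0.
  have e2 : 0 < e / 2 by rewrite divr_gt0.
  have y_gt0 : 0 < `|y| + 1 by rewrite ltr_wpDl.
  have [x' Mx' xx'] := Mx _ (divr_gt0 e2 y_gt0).
  have x'_gt0 : 0 < `|x'| + 1 by rewrite ltr_wpDl.
  have [y' My' yy'] := My _ (divr_gt0 e2 x'_gt0).
  exists (x' * y'); first exact: Mmul.
  have -> : x * y - x' * y' = (x - x') * y + x' * (y - y').
    by rewrite mulrBl mulrBr addrA subrK.
  rewrite [e]splitr; apply: le_lt_trans (ler_normD _ _) _; apply: ltrD.
    by apply: le_lt_trans (norm_mul_le _ _) _; exact: lt.
  by apply: le_lt_trans (norm_mul_le _ _) _; rewrite mulrC; exact: lt.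
- move=> x Mx e e_gt0; have [y My xy] := Mx _ e_gt0.
  by exists (star y); [exact: Mstar|rewrite -starN -starD norm_star].
Qed.

End CStarAlgebras.

(** * Integer powers of a unitary *)

Section UnitaryPowers.
Variables (R : realType) (A : cstarAlgType R) (u : A).
Hypothesis u_unitary : Defs.is_unitary u.
Implicit Types a b m : int.
Let starVu : star u * u = 1 := proj1 u_unitary.
Let ustarV : u * star u = 1 := proj2 u_unitary.

Lemma unitary_powS m : unitary_pow u (m + 1) = unitary_pow u m * u.
Proof.
case: m => [n|[|n]].
- by rewrite -PoszD addn1 /= exprSr.
- by rewrite /= expr1 starVu.
- have -> : Negz n.+1 + 1 = Negz n by lia.
  by rewrite /= [star u ^+ n.+2]exprSr -mulrA starVu mulr1.
Qed.

Lemma unitary_powD a b :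
  unitary_pow u (a + b) = unitary_pow u a * unitary_pow u b.
Proof.
elim/int_ind: b => [|n IHn|n IHn]; first by rewrite addr0 /= expr0 mulr1.
- have -> : a + n.+1 = (a + n) + 1 by lia.
  by rewrite unitary_powS IHn /= exprSr mulrA.
- have cancel m : unitary_pow u m = unitary_pow u (m - 1) * u.
    by rewrite -unitary_powS subrK.
  have e m : unitary_pow u (m - 1) = unitary_pow u m * star u.
    by rewrite (cancel m) -mulrA ustarV mulr1.
  have -> : - n.+1%:Z = - n%:Z - 1 by lia.
  by rewrite addrA !e IHn mulrA.
Qed.

Lemma star_unitary_pow m : star (unitary_pow u m) = unitary_pow u (- m).
Proof.
by case: m => [[|n]|n]; rewrite /= ?expr0 ?star1 // starX ?starK.
Qed.

Lemma unitary_pow_isometry m : is_isometry (unitary_pow u m).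
Proof. by rewrite /is_isometry star_unitary_pow -unitary_powD addNr. Qed.

End UnitaryPowers.

(** * The dense *-subalgebra spanned by words *)

Section Words.
Variables (R : realType) (P : set nat) (A : cstarAlgType R).
Variables (u : A) (s : nat -> A).
Hypothesis P_gt0 : forall p, P p -> (0 < p)%N.
Hypothesis P_submonoid : submonoid P.
Hypothesis rel : Q_relations P u s.
Implicit Types (a b k l m n : int) (p q r : nat) (x y : A).

Local Notation "u ^z m" := (unitary_pow u m) (at level 30).
Let P1 : P 1%N := proj1 P_submonoid.
Let PM p q : P p -> P q -> P (p * q)%N := @proj2 _ _ P_submonoid p q.
Let uD a b : u ^z (a + b) = u ^z a * u ^z b := unitary_powD (Q_unitary rel) a b.
Let ustar m : star (u ^z m) = u ^z (- m) := star_unitary_pow u m.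

Lemma star_su p m : P p ->
  u ^z m * star (s p) = star (s p) * u ^z (p%:Z * m).
Proof.
move=> Pp; have := congr1 star (Q_I rel (- m) Pp).
by rewrite !star_mul !ustar mulrN !opprK.
Qed.

(** All computations with words reduce to this compression by a single [s_p]
    and to the vanishing half of relation (II). *)
Lemma compress_upow p n : P p ->
  star (s p) * u ^z n * s p = if (p%:Z %| n)%Z then u ^z (n %/ p)%Z else 0.
Proof.
move=> Pp; case: ifPn => [/divzK pn|npn].
  rewrite -{1}pn [_ * p%:Z]mulrC -mulrA -(Q_I rel _ Pp) mulrA.
  by rewrite (Q_isometry rel Pp) mul1r.
apply: (Q_II0 rel) => // -[m1 [m2 e]]; case/negP: npn.
by rewrite e -mulrDr dvdz_mulr.
Qed.

Definition word m p q n : A := u ^z m * s p * star (s q) * u ^z n.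

Inductive word_span : set A :=
| word_span0 : word_span 0
| word_span_cons c m p q n x : P p -> P q -> word_span x ->
    word_span (c *: word m p q n + x).

Lemma word_spanW m p q n : P p -> P q -> word_span (word m p q n).
Proof.
move=> Pp Pq; rewrite -[word _ _ _ _]scale1r -[_ *: _]addr0.
exact: word_span_cons word_span0.
Qed.

Lemma word_spanD x y : word_span x -> word_span y -> word_span (x + y).
Proof.
move=> + yS; elim=> [|c m p q n z Pp Pq _ IH]; first by rewrite add0r.
by rewrite -addrA; exact: word_span_cons.
Qed.

Lemma word_spanZ c x : word_span x -> word_span (c *: x).
Proof.
elim=> [|d m p q n z Pp Pq _ IH]; first by rewrite scaler0; constructor.
by rewrite scalerDr scalerA; exact: word_span_cons.
Qed.

Lemma word_span_mull y :
  (forall m p q n, P p -> P q -> word_span (y * word m p q n)) ->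
  forall x, word_span x -> word_span (y * x).
Proof.
move=> yW x; elim=> [|c m p q n z Pp Pq _ IH].
  by rewrite mulr0; constructor.
by rewrite mulrDr -scalerAr; apply: word_spanD => //; apply/word_spanZ/yW.
Qed.

Lemma word_span_upow l x : word_span x -> word_span (u ^z l * x).
Proof.
apply: word_span_mull => m p q n Pp Pq.
by rewrite /word !mulrA -uD; exact: word_spanW.
Qed.

Lemma word_span_s r x : P r -> word_span x -> word_span (s r * x).
Proof.
move=> Pr; apply: word_span_mull => m p q n Pp Pq.
rewrite /word !mulrA (Q_I rel _ Pr) -(mulrA _ (s r)) (Q_mul rel Pr Pp).
by apply: word_spanW => //; exact: PM.
Qed.

(** To move [s_r^*] past a word, insert the partition of unity (III) for [r] to
    the right of [s_p]. This turns [s_r^* u^m s_p] into a sum of terms that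
    contain a compression of a power of [u] by the single isometry [s_r], and so
    makes no reference to least common multiples in [P]. *)
Lemma word_span_star_s r x : P r -> word_span x -> word_span (star (s r) * x).
Proof.
move=> Pr; apply: word_span_mull => m p q n Pp Pq.
have -> : star (s r) * word m p q n = \sum_(0 <= j < r)
    (star (s r) * u ^z (m + p%:Z * j%:Z) * s r) *
    word 0 p (q * r) (n - q%:Z * j%:Z).
  rewrite /word -[s p in LHS]mulr1 -(Q_III rel Pr) !(mulr_sumr, mulr_suml).
  apply: eq_bigr => j _; rewrite uD (_ : u ^z 0 = 1) // mul1r.
  rewrite -(Q_mul rel Pq Pr) star_mul [n - _]addrC uD -mulrN.
  rewrite -!mulrA (mulrA (star (s q))) -(star_su _ Pq).
  rewrite (mulrA (s r) (s p)) (Q_mul rel Pr Pp) mulnC -(Q_mul rel Pp Pr).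
  by rewrite !mulrA -(mulrA _ (s p)) (Q_I rel _ Pp) !mulrA.
elim/big_ind: _ => [||j _]; [exact: word_span0|exact: word_spanD|].
rewrite compress_upow //; case: ifP => _; last by rewrite mul0r; constructor.
by apply/word_span_upow/word_spanW => //; exact: PM.
Qed.

Lemma word_span_mul x y : word_span x -> word_span y -> word_span (x * y).
Proof.
move=> + yS; elim=> [|c m p q n z Pp Pq _ IH].
  by rewrite mul0r; constructor.
rewrite mulrDl -scalerAl; apply: word_spanD => //; apply: word_spanZ.
rewrite /word -!mulrA; apply/word_span_upow/word_span_s => //.
by apply/word_span_star_s => //; exact: word_span_upow.
Qed.

Lemma word_span_star x : word_span x -> word_span (star x).
Proof.
elim=> [|c m p q n z Pp Pq _ IH]; first by rewrite star0; constructor.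
rewrite starD starZ /word !star_mul !ustar starK !mulrA.
exact: word_span_cons.
Qed.

Lemma word_upow m : u ^z m = word m 1 1 0.
Proof. by rewrite /word (Q_one rel) star1 !mulr1. Qed.

Lemma word_s p : s p = word 0 p 1 0.
Proof. by rewrite /word (Q_one rel) star1 !mulr1 mul1r. Qed.

Lemma word_span_dense :
  cstar_generated (u |` [set s p | p in P]) `<=` approximable word_span.
Proof.
apply: smallest_sub.
- apply: closed_star_subalgebra_approximable.
  + by have := word_spanW 0 0 P1 P1; rewrite -word_upow.
  + by move=> c x y xS yS; apply: word_spanD => //; exact: word_spanZ.
  + exact: word_span_mul.
  + exact: word_span_star.
- move=> _ [->|[p Pp <-]]; apply: sub_approximable.
  + by have := word_spanW 1 0 P1 P1; rewrite -word_upow.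
  + by rewrite word_s; exact: word_spanW.
Qed.

(** * Compressing words to scalars *)

(** The excluded [k] is the fixed point of [i |-> m + p (i + n) / q], if [p] and
    [q] differ and the fixed point is an integer. Writing [m - k = p a] and
    [n + k = q b], the compression is [s_(qr)^* u^(a + b) s_(pr)], which can
    only be nonzero if [r] divides [a + b]. As [r] exceeds [|a + b|] this means
    [a + b = 0], that is, [k] is a fixed point, which leaves only [p = q]. *)
Lemma compress_word m p q n k r : P p -> P q -> P r ->
  (p != q -> k != ((q%:Z * m + p%:Z * n) %/ (q%:Z - p%:Z))%Z) ->
  (`|m - k| + `|(n + k)%R| < r)%N ->
  exists c : R[i],
    star (u ^z k * s (p * (q * r))%N) * word m p q n *
    (u ^z k * s (p * (q * r))%N) = c%:A.
Proof.
move=> Pp Pq Pr k_good r_large.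
have -> : star (u ^z k * s (p * (q * r))%N) * word m p q n *
    (u ^z k * s (p * (q * r))%N) =
  star (s (q * r)%N) * ((star (s p) * u ^z (m - k) * s p) *
    (star (s q) * u ^z (n + k) * s q)) * s (p * r)%N.
  rewrite {2}mulnCA -(Q_mul rel Pp (PM Pq Pr)) -(Q_mul rel Pq (PM Pp Pr)).
  by rewrite /word !star_mul ustar [m - k]addrC !uD !mulrA.
rewrite !compress_upow //.
have zero : exists c : R[i], 0 = c%:A :> A by exists 0; rewrite scale0r.
case: ifP => [/divzK|_]; last by rewrite mul0r mulr0 mul0r.
set a := (_ %/ _)%Z => ea.
case: ifP => [/divzK|_]; last by rewrite !mulr0 mul0r.
set b := (_ %/ _)%Z => eb.
clearbody a b.
have p_gt0 := P_gt0 Pp; have q_gt0 := P_gt0 Pq.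
rewrite -uD; have [ab0|ab0] := eqVneq (a + b) 0.
- have [epq|npq] := eqVneq p q.
    exists 1; rewrite scale1r ab0 /= expr0 mulr1 epq.
    by apply: (Q_isometry rel); exact: PM.
  case/negP: (k_good npq); apply/eqP.
  have -> : q%:Z * m + p%:Z * n = k * (q%:Z - p%:Z).
    have -> : m = a * p%:Z + k by rewrite ea subrK.
    have -> : n = - a * q%:Z - k by rewrite (addr0_eq ab0) eb addrK.
    by ring.
  by rewrite mulzK // subr_eq0; apply: contra npq => /eqP [->].
- rewrite (Q_II0 rel) //; [exact: PM|exact: PM|].
  case=> m1 [m2 eab].
  have r_dvd : (r %| `|(a + b)%R|)%N.
    have -> : a + b = r%:Z * (q%:Z * m1 + p%:Z * m2).
      by rewrite eab !PoszM; ring.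
    by rewrite abszM dvdn_mulr.
  have : (r <= `|(a + b)%R|)%N by rewrite dvdn_leq // absz_gt0.
  have tri : (`|(a + b)%R| <= `|a| + `|b|)%N by clear; lia.
  apply/negP; rewrite -ltnNge; apply: leq_ltn_trans tri _.
  apply: leq_ltn_trans r_large.
  by rewrite -ea -eb !abszM !absz_nat leq_add ?leq_pmulr.
Qed.

(** A single choice of [k] and [r] has to serve all the words of the
    combination. Each word excludes at most one [k] and, once [k] is chosen,
    asks for an [r] that is divisible by some [d] and has a large cofactor;
    these conditions are compatible. *)
Lemma compress_word_span x : word_span x ->
  exists F : seq int, forall k, k \notin F ->
  exists d N, P d /\ forall r, P r -> (N < r)%N ->
  exists c : R[i],
    star (u ^z k * s (d * r)%N) * x * (u ^z k * s (d * r)%N) = c%:A.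
Proof.
elim=> [|c m p q n y Pp Pq _ [F IH]].
  exists [::] => k _; exists 1%N, 0%N; split=> // r _ _; exists 0.
  by rewrite mulr0 mul0r scale0r.
(* for [p = q] the quotient is 0, and excluding it does no harm *)
exists (((q%:Z * m + p%:Z * n) %/ (q%:Z - p%:Z))%Z :: F) => k.
rewrite inE negb_or => /andP[k_good /IH[d [N [Pd dN]]]].
exists (p * q * d)%N, (N + (`|m - k| + `|(n + k)%R|))%N; split.
  by do ![exact: Pd|exact: Pp|exact: Pq|apply: PM].
move=> r Pr r_large; have d_gt0 := P_gt0 Pd.
have p_gt0 := P_gt0 Pp; have q_gt0 := P_gt0 Pq.
have [|c1 e1] :=
    @compress_word m p q n k (d * r) Pp Pq (PM Pd Pr) (fun=> k_good).
  by apply: leq_trans (leq_pmull r d_gt0); lia.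
have [||c2 e2] := dN (p * q * r)%N; first by do ![exact: PM|apply: PM].
  by apply: leq_trans (leq_pmull r _); rewrite ?muln_gt0 ?p_gt0 //; lia.
exists (c * c1 + c2); rewrite scalerDl -scalerA -e1 -e2.
have -> : (d * (p * q * r) = p * q * d * r)%N by lia.
have -> : (p * (q * (d * r)) = p * q * d * r)%N by lia.
by rewrite mulrDr mulrDl -scalerAr -scalerAl.
Qed.

Lemma exists_compression x p : P p -> (1 < p)%N -> word_span x ->
  exists k r, P r /\
    exists c : R[i], star (u ^z k * s r) * x * (u ^z k * s r) = c%:A.
Proof.
move=> Pp p_gt1 /compress_word_span[F HF].
(* larger in absolute value than every excluded integer *)
pose k : int := (\sum_(i <- F) `|i|%N).+1.
have /HF[d [N [Pd dN]]] : k \notin F.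
  apply/negP => kF.
  have : (`|k| <= \sum_(i <- F) `|i|)%N by rewrite (big_rem k) //= leq_addr.
  by rewrite ltnn.
have Ppow j : P (p ^ j)%N by elim: j => [|j IH]; rewrite ?expnS //; exact: PM.
have [c e] := dN _ (Ppow N) (ltn_expl N p_gt1).
by exists k, (d * p ^ N)%N; split; [exact: PM|exists c].
Qed.

End Words.

(** * Unitaries that implement a gauge automorphism *)

Lemma monoid_gen_submonoid (S : set nat) : submonoid (monoid_gen S).
Proof.
split=> [M [[M1 _] _] //|p q Pp Pq M M_sub].
by apply: (proj2 (proj1 M_sub)); [exact: Pp|exact: Pq].
Qed.

Lemma monoid_gen_gt0 (S : set nat) :
  (forall p, S p -> (0 < p)%N) -> forall p, monoid_gen S p -> (0 < p)%N.
Proof.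
move=> S_gt0; apply: (@smallest_sub _ submonoid S [set p | (0 < p)%N]) => //.
by split=> // a b a_gt0 b_gt0; rewrite /= muln_gt0 a_gt0.
Qed.

(** With [v = u^k s_r], the commutation rules give [v^* w v = c w] for some
    [c] of modulus 1. Approximating [w] by a combination [x] of words and
    choosing [v] such that [v^* x v] is a scalar, this shows that [c w], hence
    [w], is at least as close to a scalar as [w] is to [x]. *)
Lemma gauge_commuting_near_scalar (R : realType) (P : set nat)
    (A : cstarAlgType R) (u : A) (s : nat -> A) (w : A) p :
  (forall q, P q -> (0 < q)%N) -> submonoid P -> Q_relations P u s ->
  cstar_generated (u |` [set s q | q in P]) w ->
  P p -> (1 < p)%N ->
  (forall m, w * unitary_pow u m = unitary_pow u m * w) ->
  (forall q, P q -> exists2 c : R[i], `|c| = 1 & w * s q = c *: (s q * w)) ->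
  forall e : R[i], 0 < e -> exists z : R[i], `|w - z%:A| < e.
Proof.
move=> P_gt0 P_sub rel w_gen Pp p_gt1 wu ws e e_gt0.
have [x xS wx] := word_span_dense P_sub rel w_gen e_gt0.
have [k [r [Pr [z xz]]]] := exists_compression P_gt0 P_sub rel Pp p_gt1 xS.
have [c c1 wsr] := ws _ Pr.
have c_neq0 : c != 0 by rewrite -normr_eq0 c1 oner_eq0.
set v := unitary_pow u k * s r in xz.
have v_iso : is_isometry v.
  apply: isometryM; last exact: (Q_isometry rel).
  exact: unitary_pow_isometry (Q_unitary rel) _.
have wv : star v * w * v = c *: w.
  have {}wsr : w * v = c *: (v * w).
    by rewrite /v mulrA wu -mulrA wsr -scalerAr mulrA.
  by rewrite -mulrA wsr -scalerAr mulrA v_iso mul1r.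
exists (c^-1 * z); apply: le_lt_trans wx.
rewrite -[leLHS]mul1r -c1 -normrZ scalerBr scalerA mulrA mulfV // mul1r.
rewrite -wv -xz -mulrBl -mulrBr; exact: norm_compression_le.
Qed.

Theorem corollary6p16 (R : realType) (S : set nat)
  (S_pos : forall p, S p -> (0 < p)%N)
  (S_neq1 : forall p, S p -> p <> 1%N)
  (S_coprime : forall p q, S p -> S q -> p <> q -> coprime p q)
  (A : cstarAlgType R) (u : A) (s : nat -> A)
  (A_Q : is_Q (monoid_gen S) u s)
  (gam : torus R S -> {lrmorphism A -> A})
  (gam_gauge : gauge_action u s gam) :
  outer_action gam.
Proof.
move=> chi chi_neq1 [w [[w_iso _] gamE]]; apply: chi_neq1.
have [[gam_star _ _] gam_u gam_s] := gam_gauge.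
have rel := is_Q_relations A_Q.
have P_sub := @monoid_gen_submonoid S.
have SP : S `<=` monoid_gen S by exact: sub_smallest.
have gamw a : w * a = gam chi a * w by rewrite gamE -[RHS]mulrA w_iso mulr1.
have gam_upow m : gam chi (unitary_pow u m) = unitary_pow u m.
  by case: m => n /=; rewrite rmorphXn /= ?gam_star gam_u.
have gam_P q : monoid_gen S q -> monoid_gen S q /\
    exists2 c : R[i], `|c| = 1 & gam chi (s q) = c *: s q.
  apply: (@smallest_sub _ submonoid S [set q | monoid_gen S q /\
    exists2 c : R[i], `|c| = 1 & gam chi (s q) = c *: s q]).
  - split=> [|a b [Pa [c c1 ec]] [Pb [d d1 ed]]].
      split; first exact: (proj1 P_sub).
      by exists 1; rewrite ?normr1 // (Q_one rel) rmorph1 scale1r.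
    split; first exact: (proj2 P_sub).
    exists (c * d); first by rewrite normrM c1 d1 mulr1.
    by rewrite -(Q_mul rel Pa Pb) rmorphM /= ec ed -scalerAl -scalerAr scalerA.
  - move=> p Sp; split; first exact: SP.
    have := gam_s chi (exist _ p (mem_set Sp)) => /= e.
    by eexists; last exact: e; exact/eqP/(valP (chi _)).
apply/funext => p; apply: val_inj.
have Sp : S (val p) := set_valP p.
have Pp : monoid_gen S (val p) := SP _ Sp.
have p_gt1 : (1 < val p)%N.
  by rewrite ltn_neqAle S_pos // andbT eq_sym; apply/eqP/S_neq1.
have w_central : w * s (val p) = s (val p) * w.
  apply: near_scalar_commute.
  apply: (gauge_commuting_near_scalar
    (monoid_gen_gt0 S_pos) P_sub rel _ Pp p_gt1).
  - by rewrite (is_Q_generated A_Q).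
  - by move=> m; rewrite gamw gam_upow.
  - move=> q /gam_P[_ [c c1 ec]].
    by exists c => //; rewrite gamw ec -scalerAl.
have sw_neq0 : s (val p) * w != 0.
  rewrite -normr_eq0 norm_isometry ?oner_eq0 //.
  exact: isometryM (Q_isometry rel Pp) w_iso.
apply/eqP; rewrite -subr_eq0.
have /eqP : (val (chi p) - 1) *: (s (val p) * w) = 0.
  by rewrite scalerBl scale1r scalerAl -gam_s -gamw w_central subrr.
by rewrite scaler_eq0 (negPf sw_neq0) orbF.
Qed.
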